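(* Consider a discrete-time dynamical control system $y_{i+1}=\Phi(y_i,u_i)$, $y_0=y^0$, and let $\mathcal K_{u^0},\dots,\mathcal K_{u^{n_c-1}}$ be the Koopman operators associated with the constant inputs $u^0,\dots,u^{n_c-1}$. Assume that the observation map $f$ is linear and that the system dynamics $\Phi$ is linear in $u$. Then a convex combination of operators is equal to the Koopman operator for the convex combination of the controls $u^0,\dots,u^{n_c-1}$, i.e., $$\sum_{j=0}^{n_c-1}\gamma_j\,\mathcal K_{u^j}=\mathcal K_{\overline u},$$ where $$\overline u=\sum_{j=0}^{n_c-1}\gamma_j u^j,\qquad \sum_{j=1}^{n_c-1}\gamma_j\le 1,\qquad \gamma_j\ge 0\ \text{ for all } j\in\{0,\dots,n_c-1\},$$ with $\gamma_0=1-\sum_{j=1}^{n_c-1}\gamma_j$, so that the combination is convex.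
   Context: $\mathcal Y$ is a function space of states, $U=[u^l,u^u]$ is a box of admissible control values, and $\Phi:\mathcal Y\times U\to\mathcal Y$ is, for instance, the time-$T$ map of a controlled PDE with the control held constant over each sample interval. The inputs $u^0,\dots,u^{n_c-1}\in U$ are fixed. For a constant input $\overline u$, the autonomous system is $\Phi_{\overline u}(y)=\Phi(y,\overline u)$. The observation map $f$ assigns to a state $y\in\mathcal Y$ the observation $z=f(y)\in\mathbb R^q$. The Koopman operator of the autonomous system $\Phi_{\overline u}$ is the linear operator on observables of the state given by $(\mathcal K_{\overline u}f)(y)=f(\Phi_{\overline u}(y))$. The theorem is presented as a result for control affine systems. *)

(* Defs.v *)
From HB Require Import structures.
From mathcomp Require Import all_boot all_order all_algebra.
From mathcomp Require Import boolp functions reals.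

Set Implicit Arguments.
Unset Strict Implicit.
Unset Printing Implicit Defensive.

Import Order.TTheory GRing.Theory Num.Theory.
Local Open Scope ring_scope.

Definition box (R : realType) (m : nat) (ul uu : 'rV[R]_m) : pred 'rV[R]_m :=
  [pred u : 'rV[R]_m | [forall i, ul 0 i <= u 0 i <= uu 0 i]].

Definition control (R : realType) (m : nat) (ul uu : 'rV[R]_m) : Type :=
  {u : 'rV[R]_m | u \in box ul uu}.

(* The dynamics of a control-affine system: linear in the control up to a drift
   term g that does not depend on it (g = 0 gives the strictly linear case).
   Nothing is assumed about the dependence on the state y. *)
Definition control_affine (R : realType) (m : nat) (ul uu : 'rV[R]_m)
    (Y : lmodType R) (Phi : Y -> control ul uu -> Y) : Prop :=
  exists (g : Y -> Y) (B : Y -> {linear 'rV[R]_m -> Y}),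
    forall (y : Y) (u : control ul uu), Phi y u = g y + B y (val u).

(* The observables Y -> 'rV_q are arbitrary functions; they form a real vector
   space under the pointwise operations, and so do the operators on them. *)
Definition koopman (R : realType) (q : nat) (Y : Type) (T : Y -> Y)
    (f : Y -> 'rV[R]_q) : Y -> 'rV[R]_q :=
  fun y => f (T y).

Lemma koopman_is_linear (R : realType) (q : nat) (Y : Type) (T : Y -> Y) :
  linear (@koopman R q Y T).
Proof. by []. Qed.

HB.instance Definition _ (R : realType) (q : nat) (Y : Type) (T : Y -> Y) :=
  GRing.isLinear.Build R (Y -> 'rV[R]_q) (Y -> 'rV[R]_q) *:%R
    (@koopman R q Y T) (@koopman_is_linear R q Y T).

Definition koopman_control (R : realType) (m q : nat) (ul uu : 'rV[R]_m)
    (Y : Type) (Phi : Y -> control ul uu -> Y) (u : control ul uu) :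
    (Y -> 'rV[R]_q) -> (Y -> 'rV[R]_q) :=
  koopman (fun y => Phi y u).

(* Main.v *)
Require Import Defs.
From HB Require Import structures.
From mathcomp Require Import all_boot all_order all_algebra.
From mathcomp Require Import boolp functions reals.

Set Implicit Arguments.
Unset Strict Implicit.
Unset Printing Implicit Defensive.

Import Order.TTheory GRing.Theory Num.Theory.
Local Open Scope ring_scope.

(** Composition with a linear observation turns convex combinations of successor
    states into convex combinations of observations, so everything reduces to
    the state equation Phi y ubar = \sum_j gamma_j Phi y (u_j).  The
    control-dependent part of Phi y is linear and commutes with any combination;
    the drift g y is reproduced exactly because the weights sum to one
    ([affine_convex_comb]).  Nonnegativity of the weights serves a different
    purpose: it keeps the combined control inside the box of admissible values
    ([box_convex_comb]), so that the combined control really is a [control]. *)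

Lemma box_convex_comb (R : realType) (m : nat) (I : finType)
    (ul uu : 'rV[R]_m) (gamma : I -> R) (v : I -> 'rV[R]_m) :
  (forall j, 0 <= gamma j) -> \sum_j gamma j = 1 ->
  (forall j, v j \in box ul uu) ->
  \sum_j gamma j *: v j \in box ul uu.
Proof.
move=> gamma_ge0 gamma_sum1 v_box; rewrite inE; apply/forallP => i.
have v_bounds j : ul 0 i <= v j 0 i <= uu 0 i.
  by move: (v_box j); rewrite inE => /forallP.
(* Each bound is itself the weighted average of its constant value. *)
have constE (c : R) : c = \sum_j gamma j * c.
  by rewrite -mulr_suml gamma_sum1 mul1r.
rewrite summxE (constE (ul 0 i)) (constE (uu 0 i)).
by apply/andP; split; apply: ler_sum => j _; rewrite !mxE ler_wpM2l//;
  case/andP: (v_bounds j).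
Qed.

Lemma affine_convex_comb (R : pzRingType) (V W : lmodType R) (I : finType)
    (c : W) (L : {linear V -> W}) (gamma : I -> R) (v : I -> V) :
  \sum_j gamma j = 1 ->
  \sum_j gamma j *: (c + L (v j)) = c + L (\sum_j gamma j *: v j).
Proof.
move=> gamma_sum1; under eq_bigr do rewrite scalerDr -linearZ.
by rewrite big_split /= -scaler_suml gamma_sum1 scale1r linear_sum.
Qed.

Theorem theorem3p1 (R : realType) (m q N : nat) (ul uu : 'rV[R]_m)
    (Y : lmodType R) (Phi : Y -> control ul uu -> Y)
    (f : {linear Y -> 'rV[R]_q})
    (u : 'I_N.+1 -> control ul uu) (gamma : 'I_N.+1 -> R) :
  control_affine Phi ->
  (forall j, 0 <= gamma j) ->
  \sum_(j < N.+1 | j != ord0) gamma j <= 1 ->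
  gamma ord0 = 1 - \sum_(j < N.+1 | j != ord0) gamma j ->
  exists ubar : control ul uu,
    val ubar = \sum_(j < N.+1) gamma j *: val (u j) /\
    (\sum_(j < N.+1) gamma j *: koopman_control Phi (u j)) f =
      koopman_control Phi ubar f.
Proof.
move=> [g [B PhiE]] gamma_ge0 _ gamma0E.
have gamma_sum1 : \sum_j gamma j = 1.
  by rewrite (bigD1 ord0)//= gamma0E subrK.
have ubar_box := box_convex_comb gamma_ge0 gamma_sum1 (fun j => valP (u j)).
exists (exist (fun v => v \in box ul uu) _ ubar_box); split; first by [].
apply/funext => y; rewrite !fct_sumE /koopman_control /koopman PhiE /=.
rewrite -(affine_convex_comb _ _ _ gamma_sum1) linear_sum.
by apply: eq_bigr => j _; rewrite linearZ -PhiE.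
Qed.
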